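(* Let $G$ be a cyclically $4$-edge-connected cubic graph of order $n$. Then $V(G)$ has a partition $\{A,J\}$ such that $G[A]$ is a tree and $J$ is independent or near-independent; moreover, $J$ is independent if and only if $n\equiv 2\pmod 4$.
   Context: Graphs are finite; loops and multiple edges are allowed; a cubic graph is $3$-regular. $G[X]$ denotes the subgraph induced by $X\subseteq V(G)$. A set $J$ of vertices is independent if $G[J]$ has no edges and near-independent if $G[J]$ has exactly one edge. A set $B\subseteq E(G)$ is cycle-separating if $G-B$ is disconnected and at least two of its components contain cycles. A connected graph $G$ is cyclically $k$-edge-connected if no set of fewer than $k$ edges is cycle-separating in $G$. *)

(* Defs.v *)
(* Finite multigraphs (loops and parallel edges allowed):
   a vertex finType V, an edge finType E, and an endpoint map ends : E -> V * V
   (the pair is read as unordered). *)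
From mathcomp Require Import all_boot.
Set Implicit Arguments. Unset Strict Implicit. Unset Printing Implicit Defensive.

Section Multigraph.
Variables (V E : finType) (ends : E -> V * V).

Definition incident (e : E) (v : V) : bool := ((ends e).1 == v) || ((ends e).2 == v).

(* degree of v in the spanning subgraph with edge set F; a loop counts twice *)
Definition deg_in (F : {set E}) (v : V) : nat :=
  #|[set e in F | (ends e).1 == v]| + #|[set e in F | (ends e).2 == v]|.

Definition cubic : Prop := forall v : V, deg_in setT v = 3.

Definition adj (F : {set E}) : rel V :=
  fun x y => [exists e in F, (ends e == (x, y)) || (ends e == (y, x))].

(* the subgraph (S, F) (with F an edge set whose ends lie in S) is connected:
   S nonempty and any two vertices of S joined by a walk using edges of F *)
Definition connected_sub (S : {set V}) (F : {set E}) : Prop :=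
  S != set0 /\ forall x y, x \in S -> y \in S -> connect (adj F) x y.

Definition vset (C : {set E}) : {set V} := [set v | [exists e in C, incident e v]].

Definition is_cycle (C : {set E}) : Prop :=
  C != set0 /\ connected_sub (vset C) C /\ forall v, v \in vset C -> deg_in C v = 2.

Definition has_cycle (F : {set E}) : Prop := exists C : {set E}, C \subset F /\ is_cycle C.

Definition induced_edges (X : {set V}) : {set E} :=
  [set e | ((ends e).1 \in X) && ((ends e).2 \in X)].

Definition graph_connected : Prop := connected_sub setT setT.

Definition cycle_separating (B : {set E}) : Prop :=
  (exists x y, ~~ connect (adj (~: B)) x y) /\
  exists (C1 C2 : {set E}) (x1 x2 : V),
    [/\ C1 \subset ~: B, is_cycle C1, C2 \subset ~: B & is_cycle C2] /\
    [/\ x1 \in vset C1, x2 \in vset C2 & ~~ connect (adj (~: B)) x1 x2].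

Definition cyclically_k_edge_connected (k : nat) : Prop :=
  graph_connected /\ forall B : {set E}, #|B| < k -> ~ cycle_separating B.

Definition induced_tree (X : {set V}) : Prop :=
  connected_sub X (induced_edges X) /\ ~ has_cycle (induced_edges X).

Definition independent (J : {set V}) : Prop := #|induced_edges J| = 0.
Definition near_independent (J : {set V}) : Prop := #|induced_edges J| = 1.

End Multigraph.

(* Main.v *)
Require Import Defs.
From mathcomp Require Import all_boot.
From mathcomp Require Import all_algebra lra zify.
Set Implicit Arguments. Unset Strict Implicit. Unset Printing Implicit Defensive.
Import GRing.Theory Num.Theory.

(* Let Z(F) be the space of rational flows carried by an edge set F.  Choose a skew
   matrix S on the edges, supported on pairs of adjacent edges, whose restrictions to
   all the spaces Z(F) have as large a rank as possible.  Maximality forces any two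
   adjacent edges e, f to satisfy z_e z'_f = z_f z'_e on the radical of S on Z(F).

   If the radical is zero, S pairs off all of Z(F): one can delete disjoint pairs of
   adjacent edges, each lowering dim Z by two, until a forest with the same components
   is left.  In a cubic graph a common end of each pair is a leaf of that forest, and
   these vertices form J.

   Otherwise delete, one at a time, edges whose coordinate vanishes on the radical;
   deleting a non-bridge lowers dim Z by one and raises the dimension of the radical.
   In the end the radical has dimension at most the number b of components with edges,
   and these contain cycles.  Counting deleted edges against 2|E \ F0| >= 4b + 3t
   (t isolated vertices), as given by cyclic connectivity, shows that the initial
   radical had dimension at most one.

   This is applied to F = E when n = 2 mod 4, and, when n = 0 mod 4, to the graph
   obtained by isolating both ends u, w of an arbitrary edge, which then join J.
   In both cases dim Z(F) is even, so the radical is zero. *)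

(** * Matrix rank under perturbation *)

Section LinearAlgebra.
Local Open Scope ring_scope.

Lemma exists_nonroot (P : {poly rat}) : P != 0 ->
  exists s, s != 0 /\ P.[s] != 0.
Proof.
move=> nzP; pose rs := [seq i.+1%:R : rat | i <- iota 0 (size P)].
have Urs: uniq rs.
  rewrite map_inj_uniq ?iota_uniq // => i j /eqP.
  by rewrite eqr_nat => /eqP [].
have : ~~ all (root P) rs.
  apply/negP => Prs; have := max_poly_roots nzP Prs Urs.
  by rewrite size_map size_iota ltnn.
case/allPn => s /mapP [i _ ->] Ps.
by exists i.+1%:R; rewrite pnatr_eq0.
Qed.

(** [L] and [R] compress [A] to an identity of size [\rank A]. The determinant of the compressed
    [A + s *: B] is a polynomial in [s] with value 1 at 0, and where it is nonzero the rank cannot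
    have dropped. *)
Lemma rank_perturb (p q : nat) (A B : 'M[rat]_(p, q)) :
  exists P : {poly rat}, P != 0 /\
    forall s : rat, P.[s] != 0 -> (\rank A <= \rank (A + s *: B)%R)%N.
Proof.
have /row_fullP [L L1] : row_full (col_base A) by rewrite col_base_full.
have /row_freeP [R R1] : row_free (row_base A) by rewrite row_base_free.
have LAR : L *m A *m R = 1%:M.
  have -> : L *m A *m R = L *m (col_base A *m row_base A) *m R by rewrite mulmx_base.
  by rewrite mulmxA L1 mul1mx R1.
pose N := L *m B *m R.
pose P := \det (1%:M + 'X *: map_mx polyC N).
have Ps s : P.[s] = \det (1%:M + s *: N).
  rewrite -horner_evalE -det_map_mx; congr (\det _).
  apply/matrixP => i j; rewrite !mxE /= horner_evalE !hornerE.
  by case: (i == j); rewrite !hornerE.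
exists P; split.
  apply/eqP => P0; have := Ps 0.
  by rewrite P0 horner0 scale0r addr0 det1 => /eqP; rewrite eq_sym oner_eq0.
move=> s; rewrite Ps -unitfE -unitmxE => U.
have rk : \rank (L *m (A + s *: B)%R *m R) = \rank A.
  by rewrite mulmxDr mulmxDl LAR -scalemxAr -scalemxAl mxrank_unit.
rewrite -[leqLHS]rk.
exact: leq_trans (mxrankM_maxl _ _) (mxrankM_maxr _ _).
Qed.

Lemma rank_row_span (p q : nat) (X : 'M[rat]_(p, q)) (T : finType) (R : {set T})
    (u : T -> 'rV[rat]_q) :
  (forall i, row i X <= \sum_(r in R) <<u r>>)%MS -> (\rank X <= #|R|)%N.
Proof.
move=> H; have /mxrankS/leq_trans : (X <= \sum_(r in R) <<u r>>)%MS by apply/row_subP.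
apply; apply: leq_trans (mxrank_sum_leqif _) _ => /=.
by rewrite -sum1_card leq_sum // => r _; rewrite genmxE rank_leq_row.
Qed.

End LinearAlgebra.

(** * Flow spaces and radicals of skew forms *)

Section Flows.
Local Open Scope ring_scope.
Variables (E : finType) (n : nat) (D : 'M[rat]_(#|E|, n)).
Implicit Types (F : {set E}) (e f : E) (S : 'M[rat]_#|E|).

(** Spaces of edge vectors are row spaces of square matrices; this one is the coordinate projector
    onto [F]. The matrix [D] stays abstract until an incidence matrix takes its place. *)
Definition onmx F : 'M[rat]_#|E| := diag_mx (\row_i (enum_val i \in F)%:R).
Definition flows F : 'M[rat]_#|E| := (onmx F :&: kermx D)%MS.
Definition at_edge e : 'cV[rat]_#|E| := delta_mx (enum_rank e) 0.
Definition radical S F : 'M[rat]_#|E| :=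
  (flows F :&: kermx (S *m (flows F)^T))%MS.
Definition skew_mx S := S^T = - S.

Lemma mul_at_edge p (X : 'M[rat]_(p, #|E|)) e : X *m at_edge e = col (enum_rank e) X.
Proof. by rewrite colE. Qed.

Lemma mul_onmx p (X : 'M[rat]_(p, #|E|)) F i j :
  (X *m onmx F) i j = X i j * (enum_val j \in F)%:R.
Proof. by rewrite mul_mx_diag !mxE. Qed.

Lemma onmxP p (X : 'M[rat]_(p, #|E|)) F :
  reflect (forall e, e \notin F -> X *m at_edge e = 0) (X <= onmx F)%MS.
Proof.
apply: (iffP idP) => [/submxP [Y ->] e eF | H].
  apply/matrixP => i j; rewrite mul_at_edge mxE mul_onmx enum_rankK.
  by rewrite (negPf eF) mulr0 mxE.
have -> : X = X *m onmx F; last exact: submxMl.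
apply/matrixP => i j; rewrite mul_onmx.
have [_|/H] := boolP (enum_val j \in F); first by rewrite mulr1.
by move/matrixP/(_ i 0); rewrite mul_at_edge !mxE enum_valK => ->; rewrite mul0r.
Qed.

Lemma rank_onmx F : \rank (onmx F) = #|F|.
Proof.
(* [P] selects the coordinates in [F], factoring the projector through dimension [#|F|]. *)
pose P : 'M[rat]_(#|F|, #|E|) := \matrix_(k, j) (enum_val k == enum_val j)%:R.
have PP : P *m P^T = 1%:M.
  apply/matrixP => k l; rewrite !mxE (bigD1 (enum_rank (enum_val k))) //= !mxE.
  rewrite enum_rankK eqxx mul1r big1 ?addr0 => [|j jk].
    by rewrite (inj_eq enum_val_inj) eq_sym.
  rewrite !mxE; case: eqP => [e|_]; last by rewrite mul0r.
  by rewrite e enum_valK eqxx in jk.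
have PtP : P^T *m P = onmx F.
  apply/matrixP => i j; rewrite !mxE.
  have [iF | iF] := boolP (enum_val i \in F).
    rewrite (bigD1 (enum_rank_in iF (enum_val i))) //= !mxE enum_rankK_in // eqxx mul1r.
    rewrite (inj_eq enum_val_inj) big1 ?addr0 => [|k ki]; first by case: eqP.
    rewrite !mxE; case: eqP => [e|_]; last by rewrite mul0r.
    by case/eqP: ki; apply: enum_val_inj; rewrite enum_rankK_in.
  rewrite mul0rn big1 // => k _; rewrite !mxE; case: eqP => [e|_]; last by rewrite mul0r.
  by rewrite -e enum_valP in iF.
apply/eqP; rewrite eqn_leq; apply/andP; split.
  by rewrite -PtP (leq_trans (mxrankM_maxr _ _)) ?rank_leq_row.
have <- : \rank (P *m onmx F *m P^T) = #|F|.
  by rewrite -PtP mulmxA PP mul1mx PP mxrank1.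
exact: leq_trans (mxrankM_maxl _ _) (mxrankM_maxr _ _).
Qed.

Lemma flowsP p (X : 'M[rat]_(p, #|E|)) F :
  reflect (X *m D = 0 /\ forall e, e \notin F -> X *m at_edge e = 0)
          (X <= flows F)%MS.
Proof.
rewrite sub_capmx; apply: (iffP andP) => [[/onmxP H /sub_kermxP] | [/sub_kermxP H /onmxP]] //.
Qed.

Lemma rank_flows F : (\rank (onmx F *m D) + \rank (flows F) = #|F|)%N.
Proof. by rewrite mxrank_mul_ker rank_onmx. Qed.

Lemma flowsD1 e F : (flows (F :\ e) :=: flows F :&: kermx (at_edge e))%MS.
Proof.
apply/eqmxP/andP; split; apply/rV_subP => z.
  case/flowsP => zD H; rewrite sub_capmx; apply/andP; split.
    by apply/flowsP; split=> // f fF; apply: H; rewrite !inE (negPf fF) andbF.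
  by apply/sub_kermxP; apply: H; rewrite !inE eqxx.
rewrite sub_capmx => /andP [/flowsP [zD H] /sub_kermxP ze].
apply/flowsP; split=> // f; rewrite !inE negb_and negbK.
by case/orP => [/eqP -> // | /H].
Qed.

Lemma flowsS F F' : F \subset F' -> (flows F <= flows F')%MS.
Proof.
move=> sFF'; apply/flowsP; have [XD H] := flowsP _ _ (submx_refl (flows F)).
by split=> // e eF'; apply: H; apply: contra eF'; apply: (subsetP sFF').
Qed.

(** For an incidence matrix and [e] in [F], the hypothesis says that [e] is a bridge. *)
Lemma flowsD1_bridge e F : flows F *m at_edge e = 0 -> (flows (F :\ e) :=: flows F)%MS.
Proof.
move=> H; apply: eqmx_trans (flowsD1 e F) _; apply/eqmxP.
by rewrite capmxSl sub_capmx submx_refl; apply/sub_kermxP.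
Qed.

Lemma rank_cV1 p (x : 'cV[rat]_p) : x != 0 -> \rank x = 1%N.
Proof.
move=> x0; apply/eqP; rewrite eqn_leq rank_leq_col /= lt0n.
by rewrite mxrank_eq0.
Qed.

Lemma rank_flowsD1 e F : flows F *m at_edge e != 0 ->
  (\rank (flows (F :\ e))).+1 = \rank (flows F).
Proof.
move=> H; rewrite (flowsD1 e F) -[RHS](mxrank_mul_ker _ (at_edge e)).
by rewrite rank_cV1.
Qed.

Lemma radicalP p (X : 'M[rat]_(p, #|E|)) S F :
  reflect ((X <= flows F)%MS /\ X *m S *m (flows F)^T = 0) (X <= radical S F)%MS.
Proof.
rewrite [(X <= radical _ _)%MS]sub_capmx; apply: (iffP andP) => [[H /sub_kermxP] | [H0 H]].
  by rewrite mulmxA.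
by split=> //; apply/sub_kermxP; rewrite mulmxA.
Qed.

Lemma rank_radical S F :
  (\rank (flows F *m S *m (flows F)^T) + \rank (radical S F) = \rank (flows F))%N.
Proof. by rewrite -mulmxA mxrank_mul_ker. Qed.

Lemma skew_form S p q (X : 'M[rat]_(p, #|E|)) (Y : 'M[rat]_(q, #|E|)) :
  skew_mx S -> X *m S *m Y^T = - (Y *m S *m X^T)^T.
Proof. by move=> sS; rewrite !trmx_mul trmxK sS mulNmx mulmxN opprK mulmxA. Qed.

Lemma radical_eq S F F' : (flows F :=: flows F')%MS ->
  (radical S F :=: radical S F')%MS.
Proof.
have sub F1 F2 : (flows F1 :=: flows F2)%MS -> (radical S F1 <= radical S F2)%MS.
  move=> H; have [XZ XS] := radicalP _ _ _ (submx_refl (radical S F1)).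
  apply/radicalP; split; first by rewrite -H.
  have /submxP [Y ->] : (flows F2 <= flows F1)%MS by rewrite H.
  by rewrite trmx_mul mulmxA XS mul0mx.
by move=> H; apply/eqmxP; rewrite !sub //; apply: eqmx_sym.
Qed.

Lemma radical_form0 S F p q (X : 'M[rat]_(p, #|E|)) (Y : 'M[rat]_(q, #|E|)) :
  (X <= radical S F)%MS -> (Y <= flows F)%MS -> X *m S *m Y^T = 0.
Proof. by move=> /radicalP [_ H] /submxP [W ->]; rewrite trmx_mul mulmxA H mul0mx. Qed.

Lemma radical_form0r S F p q (X : 'M[rat]_(p, #|E|)) (Y : 'M[rat]_(q, #|E|)) :
  skew_mx S -> (X <= radical S F)%MS -> (Y <= flows F)%MS -> Y *m S *m X^T = 0.
Proof. by move=> sS HX HY; rewrite skew_form // (radical_form0 HX HY) trmx0 oppr0. Qed.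

Lemma radical_test S F (z : 'rV[rat]_#|E|) : (z <= flows F)%MS ->
  (forall z' : 'rV[rat]_#|E|, (z' <= flows F)%MS -> z *m S *m z'^T = 0) ->
  (z <= radical S F)%MS.
Proof.
move=> zZ H; apply/radicalP; split=> //.
apply/matrixP => i j; have /matrixP/(_ i 0) := H _ (row_sub j (flows F)).
by rewrite tr_row colE mulmxA -colE (ord1 i) !mxE.
Qed.

(* A flow y of the radical with y_e <> 0 corrects any flow to one vanishing at e. *)
Lemma radicalD1_missed e S F : skew_mx S -> radical S F *m at_edge e != 0 ->
  (\rank (radical S (F :\ e)) < \rank (radical S F))%N.
Proof.
move=> sS ne0; rewrite -(mxrank_mul_ker (radical S F) (at_edge e)) rank_cV1 // ltnS.
apply: mxrankS; apply/rV_subP => z zr.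
have [zZ _] := radicalP _ _ _ zr; move: (zZ); rewrite flowsD1 sub_capmx => /andP [zZF ze].
rewrite sub_capmx ze andbT; apply: radical_test => // z' z'F.
have [i yi] : exists i, (row i (radical S F) *m at_edge e) 0 0 != 0.
  apply/existsP; apply: contraR ne0; rewrite negb_exists => /forallP H.
  apply/eqP/matrixP => i j; move: (H i); rewrite negbK -row_mul mxE (ord1 j) => /eqP ->.
  by rewrite mxE.
pose y := row i (radical S F); have yr : (y <= radical S F)%MS by exact: row_sub.
pose c := (z' *m at_edge e) 0 0 / (y *m at_edge e) 0 0.
have: (z' - c *: y <= flows (F :\ e))%MS.
  rewrite flowsD1 sub_capmx; apply/andP; split.
    have [yF _] := radicalP _ _ _ yr.
    by rewrite addmx_sub // eqmx_opp scalemx_sub.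
  apply/sub_kermxP; rewrite mulmxBl -scalemxAl /c.
  move: yi; rewrite -/y; move: (y *m _) (z' *m _) => u v u0.
  by apply/matrixP => a b; rewrite !ord1 !mxE divfK ?subrr.
move/(radical_form0 zr); rewrite linearB linearZ /= mulmxBr -scalemxAr.
by rewrite (radical_form0r sS yr zZF) scaler0 subr0.
Qed.

(** Pair the new radical with all of [flows F]. The kernel lies in [radical S F], and the rank is at
    most one because the pairing vanishes on [flows (F :\ e)], which has codimension at most one. *)
Lemma radicalD1_le e S F : skew_mx S ->
  (\rank (radical S (F :\ e)) <= (\rank (radical S F)).+1)%N.
Proof.
move=> sS; have [H | H] := eqVneq (flows F *m at_edge e) 0.
  by rewrite (radical_eq _ (flowsD1_bridge H)).
pose A := radical S (F :\ e) *m S.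
rewrite -(mxrank_mul_ker (radical S (F :\ e)) (S *m (flows F)^T)).
rewrite -addn1 addnC leq_add //.
  apply: mxrankS; apply/rV_subP => z; rewrite sub_capmx => /andP [zr /sub_kermxP zS].
  have [] := radicalP _ _ _ zr; rewrite flowsD1 sub_capmx => /andP [zF _] _.
  by apply/radicalP; rewrite -mulmxA.
rewrite mulmxA -/A -mxrank_tr trmx_mul trmxK.
rewrite -(leq_add2r (\rank (flows F :&: kermx A^T))) mxrank_mul_ker.
rewrite -(rank_flowsD1 H) add1n ltnS; apply: mxrankS.
rewrite sub_capmx; apply/andP; split; first by rewrite flowsD1 capmxSl.
apply/sub_kermxP; rewrite -[flows _]trmxK -trmx_mul.
by rewrite (radical_form0 (submx_refl _) (submx_refl _)) trmx0.
Qed.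

(* z solves S(z, -) = x_e on the flows; S being alternating, z vanishes at e. *)
Lemma radicalD1_witness e S F (z : 'rV[rat]_#|E|) : skew_mx S ->
  (z <= flows F)%MS -> z *m S *m (flows F)^T = (flows F *m at_edge e)^T ->
  (z <= radical S (F :\ e))%MS.
Proof.
move=> sS zF zS; have zS' (z' : 'rV[rat]_#|E|) : (z' <= flows F)%MS ->
    z *m S *m z'^T = (z' *m at_edge e)^T.
  by case/submxP => w ->; rewrite trmx_mul mulmxA zS -trmx_mul mulmxA.
have ze : z *m at_edge e = 0.
  have := skew_form z z sS; rewrite !zS' // trmxK => /matrixP/(_ 0 0).
  rewrite !mxE => H; apply/matrixP => i j; rewrite !ord1 !mxE; lra.
apply: radical_test => [|z']; rewrite flowsD1 sub_capmx.
  by rewrite zF; apply/sub_kermxP.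
by case/andP => z'F /sub_kermxP z'e; rewrite zS' // z'e trmx0.
Qed.

(** Since x_e vanishes on the radical, it lies in the row space of the Gram matrix [G], so S(z, -) =
    x_e for some flow z. The old radical survives the deletion and z joins it; z was not there
    before, as x_e is nonzero on the flows. *)
Lemma radicalD1_unmissed e S F : skew_mx S -> radical S F *m at_edge e = 0 ->
  flows F *m at_edge e != 0 ->
  (\rank (radical S F) < \rank (radical S (F :\ e)))%N.
Proof.
move=> sS r0 z0; pose Z := flows F; pose G := Z *m S *m Z^T.
have GT : G^T = - G by rewrite /G !trmx_mul trmxK sS mulNmx mulmxN mulmxA.
have /submxP [y yG] : ((Z *m at_edge e)^T <= G)%MS.
  rewrite submxE; apply/eqP; rewrite -[_ *m _]trmxK trmx_mul trmxK mulmxA.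
  have H : ((cokermx G)^T *m Z <= radical S F)%MS.
    apply/radicalP; split; first exact: submxMl.
    transitivity ((cokermx G)^T *m G); first by rewrite /G !mulmxA.
    by rewrite -[X in _ *m X]opprK -GT mulmxN -trmx_mul mulmx_coker trmx0 oppr0.
  by case/submxP: H => W ->; rewrite -mulmxA r0 mulmx0 trmx0.
pose z := y *m Z; have zF : (z <= flows F)%MS by exact: submxMl.
have zS : z *m S *m Z^T = (Z *m at_edge e)^T by rewrite yG /G !mulmxA.
have zr := radicalD1_witness sS zF zS.
have sub : (radical S F <= radical S (F :\ e))%MS.
  apply/rV_subP => x xr; have [xF _] := radicalP _ _ _ xr.
  apply: radical_test => [|x']; rewrite flowsD1 sub_capmx.
    rewrite xF; apply/sub_kermxP; case/submxP: xr => W ->.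
    by rewrite -mulmxA r0 mulmx0.
  by case/andP => x'F _; apply: radical_form0 xr x'F.
rewrite (ltn_leqif (mxrank_leqif_sup sub)); apply: contra z0 => /(submx_trans zr).
case/radicalP => _ /eqP; rewrite zS => /eqP /(congr1 trmx).
by rewrite trmxK trmx0 => ->.
Qed.

Lemma mul_at_edge_neq0 p q (X : 'M[rat]_(p, #|E|)) (Y : 'M[rat]_(q, #|E|)) e :
  (X <= Y)%MS -> X *m at_edge e != 0 -> Y *m at_edge e != 0.
Proof. by case/submxP => W ->; apply: contraNneq; rewrite -mulmxA => ->; rewrite mulmx0. Qed.

Lemma flows_edge e F : flows F *m at_edge e != 0 -> e \in F.
Proof.
have [_ H] := flowsP _ _ (submx_refl (flows F)).
by apply: contraNT => /H ->.
Qed.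

(* With G the Gram matrix of S on a basis B of the flows, tr (S B^T G^-1 B) is the
   dimension of the flow space, so some entry S_fe (B^T G^-1 B)_ef is nonzero. *)
Lemma nondegenerate_pair S F : skew_mx S -> radical S F = 0 -> flows F != 0 ->
  exists e f, [/\ e \in F, f \in F :\ e, S (enum_rank f) (enum_rank e) != 0,
    radical S (F :\ e :\ f) = 0 &
    (\rank (flows (F :\ e :\ f))).+2 = \rank (flows F)].
Proof.
move=> sS r0 nz; have [B [Bfree BZ]] : exists B : 'M_(\rank (flows F), #|E|),
    row_free B /\ (B :=: flows F)%MS.
  by exists (row_base (flows F)); rewrite row_base_free; split=> //; apply: eq_row_base.
pose G := B *m S *m B^T.
have Gu : G \in unitmx.
  rewrite -row_free_unit -kermx_eq0 -submx0; apply/rV_subP => y /sub_kermxP yG.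
  have : (y *m B <= radical S F)%MS.
    apply: radical_test => [|z']; rewrite -BZ; first exact: submxMl.
    by case/submxP => w ->; rewrite trmx_mul mulmxA -(mulmxA y) -(mulmxA y) -/G yG mul0mx.
  rewrite r0 => /submx0null /eqP.
  by rewrite (mulmx_free_eq0 _ Bfree) => /eqP ->; rewrite sub0mx.
pose H := B^T *m invmx G *m B.
have trH : \tr (S *m H) = (\rank (flows F))%:R.
  by rewrite /H !mulmxA mxtrace_mulC !mulmxA -/G mulmxV ?mxtrace1.
have [i [j Sij]] : exists i j, S i j * H j i != 0.
  have : [exists i, exists j, S i j * H j i != 0].
    apply: contraLR nz => no; rewrite negbK -mxrank_eq0 -(eqr_nat rat) -trH; apply/eqP.
    apply: big1 => i _; rewrite mxE big1 // => j _; apply/eqP.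
    by apply: contraR no => ne0; apply/existsP; exists i; apply/existsP; exists j.
  by case/existsP => i /existsP [j]; exists i, j.
move: Sij; rewrite mulf_eq0 negb_or => /andP [Sij Hji].
pose e := enum_val j; pose f := enum_val i.
have ej : enum_rank e = j by exact: enum_valK.
have fi : enum_rank f = i by exact: enum_valK.
(* This row solves S(z, -) = x_e on the flows, so it enters the radical once [e] is deleted. Its
   coordinate at [f] is [H j i], which is nonzero. *)
pose z := row j H.
have zE : z = row j (B^T) *m invmx G *m B by rewrite /z /H !row_mul.
have zF : (z <= flows F)%MS by rewrite -BZ zE; apply: submxMl.
have zS : z *m S *m (flows F)^T = (flows F *m at_edge e)^T.
  have /submxP [W ->] : (flows F <= B)%MS by rewrite BZ.
  have zB : z *m S *m B^T = row j B^T.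
    transitivity (row j B^T *m invmx G *m G); first by rewrite zE /G !mulmxA.
    by rewrite mulmxKV.
  by rewrite trmx_mul mulmxA zB -mulmxA !trmx_mul trmx_delta ej -rowE.
have zr := radicalD1_witness sS zF zS.
have zf : z *m at_edge f != 0.
  apply: contraNneq Hji => /matrixP/(_ 0 0).
  by rewrite mul_at_edge fi !mxE => ->.
have Fe : flows F *m at_edge e != 0.
  apply: contraNneq zf => Fe0; have : (z <= radical S F)%MS.
    by apply/radicalP; rewrite zS Fe0 trmx0.
  by rewrite r0 submx0 => /eqP ->; rewrite mul0mx.
have Ff : flows (F :\ e) *m at_edge f != 0.
  by apply: mul_at_edge_neq0 zf; have [] := radicalP _ _ _ zr.
have rf : radical S (F :\ e) *m at_edge f != 0 by apply: mul_at_edge_neq0 zf.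
exists e, f; split; first exact: flows_edge.
- exact: flows_edge.
- by rewrite ej fi.
(* Deleting [e] raises the zero radical to rank at most one; deleting [f] then strictly lowers
   it. *)
- apply/eqP; rewrite -mxrank_eq0 -leqn0 -ltnS.
  apply: leq_trans (radicalD1_missed sS rf) _.
  by apply: leq_trans (radicalD1_le _ _ sS) _; rewrite r0 mxrank0.
- by rewrite rank_flowsD1 // rank_flowsD1.
Qed.

(** Delete edges on which the radical vanishes, as long as there are any. A bridge changes neither
    rank; any other edge costs one dimension of flows and gains at least one of radical. *)
Lemma missed_everywhere S F : skew_mx S -> exists F0,
  [/\ F0 \subset F, forall e, e \in F0 -> radical S F0 *m at_edge e != 0 &
    (\rank (radical S F) + \rank (flows F) <=
     \rank (radical S F0) + \rank (flows F0))%N].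
Proof.
move=> sS; have [k] := ubnP #|F|; elim: k F => // k IH F ltFk.
have [/forall_inP H | /forall_inPn [e eF]] :=
  boolP [forall e in F, radical S F *m at_edge e != 0].
  by exists F.
rewrite negbK => /eqP r0.
have [|F0 [sF0 H leF0]] := IH (F :\ e).
  by move: ltFk; rewrite (cardsD1 e F) eF.
exists F0; split=> //; first exact: subset_trans sF0 (subD1set _ _).
apply: leq_trans leF0; have [b0 | nb] := eqVneq (flows F *m at_edge e) 0.
  by rewrite (radical_eq _ (flowsD1_bridge b0)) (flowsD1_bridge b0).
by rewrite -(rank_flowsD1 nb) addnS -addSn leq_add2r radicalD1_unmissed.
Qed.

(** The matrix of the alternating form z_e z'_f - z_f z'_e. *)
Definition wedge e f : 'M[rat]_#|E| :=
  delta_mx (enum_rank e) (enum_rank f) - delta_mx (enum_rank f) (enum_rank e).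

Lemma radical_perturb_le S N F : exists P : {poly rat}, P != 0 /\
  forall s, P.[s] != 0 ->
    (\rank (radical (S + s *: N)%R F) <= \rank (radical S F))%N.
Proof.
have [P [nzP H]] := rank_perturb (flows F *m S *m (flows F)^T) (flows F *m N *m (flows F)^T).
exists P; split=> // s /H; rewrite scalemxAl scalemxAr -mulmxDl -mulmxDr => le.
rewrite -(leq_add2l (\rank (flows F *m S *m (flows F)^T))) rank_radical.
by rewrite -(rank_radical (S + s *: N)%R F) leq_add2r.
Qed.

(** With K the radical and Z the flows, the rows of K N Z^T are not all in the row space of Z S Z^T,
    since the latter vanishes against K. They do lie in the row space of the perturbed Gram matrix,
    because K S Z^T = 0, and stacking them shows that its rank grows. *)
Lemma radical_perturb_lt S N F : skew_mx S ->
  radical S F *m N *m (radical S F)^T != 0 -> exists P : {poly rat}, P != 0 /\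
  forall s, s != 0 -> P.[s] != 0 ->
    (\rank (radical (S + s *: N)%R F) < \rank (radical S F))%N.
Proof.
move=> sS nz; pose Z := flows F; pose K := radical S F.
have [P [nzP H]] := rank_perturb (col_mx (Z *m S *m Z^T) (K *m N *m Z^T))
  (col_mx (Z *m N *m Z^T) 0).
exists P; split=> // s s0 /H.
rewrite scale_col_mx scaler0 add_col_mx addr0 scalemxAl scalemxAr -mulmxDl -mulmxDr => le.
have [KZ KS] := radicalP _ _ _ (submx_refl K).
have [W KW] := submxP KZ.
have ub : (\rank (col_mx (Z *m (S + s *: N) *m Z^T) (K *m N *m Z^T)) <=
           \rank (Z *m (S + s *: N)%R *m Z^T))%N.
  apply: mxrankS; rewrite col_mx_sub submx_refl /=.
  have -> : K *m N *m Z^T = s^-1 *: (W *m (Z *m (S + s *: N) *m Z^T)).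
    rewrite !mulmxA -KW mulmxDr mulmxDl KS add0r -scalemxAr -scalemxAl scalerA.
    by rewrite mulVf // scale1r.
  by rewrite scalemx_sub // submxMl.
have lb : (\rank (Z *m S *m Z^T) < \rank (col_mx (Z *m S *m Z^T) (K *m N *m Z^T)))%N.
  have sub : (Z *m S *m Z^T <= col_mx (Z *m S *m Z^T) (K *m N *m Z^T))%MS.
    by rewrite -addsmxE addsmxSl.
  rewrite (ltn_leqif (mxrank_leqif_sup sub)) col_mx_sub submx_refl /=.
  apply: contra nz => /submxP [Y KN].
  have KT : K^T = Z^T *m W^T by rewrite -trmx_mul -KW.
  rewrite -/K KT mulmxA KN -!mulmxA -KT (mulmxA Z).
  by rewrite (radical_form0r sS (submx_refl K) (submx_refl Z)) mulmx0.
rewrite -(ltn_add2l (\rank (Z *m S *m Z^T))) rank_radical.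
rewrite -(rank_radical (S + s *: N)%R F) ltn_add2r.
exact: leq_trans lb (leq_trans le ub).
Qed.

(** Descent from [S = 0] on the sum of the radical ranks over all [F]. If a wedge is nonzero on some
    radical, a suitable multiple of it lowers that radical and raises none: one [s] avoids the roots
    of finitely many nonzero polynomials. *)
Lemma exists_generic (r : rel E) : symmetric r -> exists S, [/\ skew_mx S,
  forall e f, S (enum_rank e) (enum_rank f) != 0 -> r e f &
  forall F e f, r e f -> radical S F *m wedge e f *m (radical S F)^T = 0].
Proof.
move=> symr.
suff H k S : (\sum_(F : {set E}) \rank (radical S F) < k)%N -> skew_mx S ->
  (forall e f, S (enum_rank e) (enum_rank f) != 0 -> r e f) -> exists S, [/\ skew_mx S,
  forall e f, S (enum_rank e) (enum_rank f) != 0 -> r e f &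
  forall F e f, r e f -> radical S F *m wedge e f *m (radical S F)^T = 0].
  apply: (H _ 0 (leqnn _)); first by rewrite /skew_mx trmx0 oppr0.
  by move=> e f; rewrite mxE eqxx.
elim: k S => // k IH S ltk sS Sr.
have [/'forall_forallP H | ] := boolP [forall F : {set E}, forall ef : E * E, r ef.1 ef.2 ==>
    (radical S F *m wedge ef.1 ef.2 *m (radical S F)^T == 0)].
  by exists S; split=> // F e f ref; have := H F (e, f); rewrite /= ref => /eqP.
case/forallPn => F0 /forallPn [[e f]] /=; rewrite negb_imply => /andP [ref nz].
pose N := wedge e f.
have [P HP] := fin_all_exists (radical_perturb_le S N).
have [Q [nzQ HQ]] := radical_perturb_lt sS nz.
have [s [s0]] : exists s, s != 0 /\ (Q * \prod_F P F).[s] != 0.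
  apply: exists_nonroot; rewrite mulf_neq0 //.
  by apply/prodf_neq0 => F _; have [] := HP F.
rewrite hornerM mulf_eq0 negb_or horner_prod => /andP [Qs /prodf_neq0 Ps].
apply: (IH (S + s *: N)).
- rewrite ltnS in ltk; apply: leq_trans ltk; rewrite (bigD1 F0) //= [X in (_ < X)%N](bigD1 F0) //=.
  rewrite -addSn leq_add ?HQ //; apply: leq_sum => F _.
  by have [_] := HP F; apply; apply: Ps.
- rewrite /skew_mx linearD linearZ /= sS opprD -scalerN; congr (_ + _ *: _).
  by rewrite /N /wedge linearB /= !trmx_delta opprB.
- move=> a b; rewrite !mxE.
  have [/Sr // | /negPn/eqP ->] := boolP (S (enum_rank a) (enum_rank b) != 0).
  rewrite add0r mulf_eq0 negb_or => /andP [_].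
  rewrite !(inj_eq enum_rank_inj).
  have [/andP [/eqP -> /eqP ->] // | _] := boolP ((a == e) && (b == f)).
  have [/andP [/eqP -> /eqP ->] | _] := boolP ((a == f) && (b == e)); first by rewrite symr.
  by rewrite subrr eqxx.
Qed.

End Flows.

(** * Degrees, cycles and cuts *)

Section Counting.
Variables (V E : finType) (ends : E -> V * V).
Implicit Types (F C : {set E}) (X Y : {set V}).
Notation deg := (deg_in ends).
Notation vset := (vset ends).
Notation ind := (induced_edges ends).

Definition cut X : {set E} := [set e | ((ends e).1 \in X) != ((ends e).2 \in X)].

Lemma deg_inE F v : deg F v = \sum_(e in F) (((ends e).1 == v) + ((ends e).2 == v)).
Proof.
by rewrite big_split /= -!big_mkcondr /= /deg_in -!sum1dep_card.
Qed.

Lemma sum_deg F X :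
  \sum_(v in X) deg F v = \sum_(e in F) (((ends e).1 \in X) + ((ends e).2 \in X)).
Proof.
rewrite (eq_bigr _ (fun v _ => deg_inE F v)) exchange_big; apply: eq_bigr => e _ /=.
have H a : \sum_(v in X) (a == v : nat) = (a \in X).
  have [aX | aX] := boolP (a \in X).
    rewrite (bigD1 a) //= eqxx big1 // => v /andP [_ /negPf]; rewrite eq_sym => -> //.
  by rewrite big1 // => v vX; case: eqP aX => // ->; rewrite vX.
by rewrite big_split /= !H.
Qed.

Lemma sum_deg_cut F X :
  \sum_(v in X) deg F v = #|F :&: cut X| + (#|F :&: ind X|).*2.
Proof.
have card (A : {set E}) : #|A| = \sum_e (e \in A : nat).
  by rewrite -sum1_card big_mkcond; apply: eq_bigr => e _; case: ifP.
rewrite sum_deg -addnn !card -!big_split [LHS]big_mkcond /=.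
apply: eq_bigr => e _; rewrite !inE.
by case: (e \in F); case: (_ \in X); case: (_ \in X).
Qed.

Lemma sum_deg_all F : \sum_v deg F v = (#|F|).*2.
Proof.
rewrite (eq_bigl (mem [set: V])) => [|v]; last by rewrite !inE.
rewrite sum_deg -addnn -sum1_card -big_split; apply: eq_bigr => e _.
by rewrite !inE.
Qed.

Lemma deg_inS F F' v : F \subset F' -> deg F v <= deg F' v.
Proof.
move=> sF; rewrite !deg_inE [leqLHS]big_mkcond [leqRHS]big_mkcond leq_sum // => e _.
by case: ifP => // /(subsetP sF) ->.
Qed.

Lemma deg_incident F e v : e \in F -> incident ends e v -> 0 < deg F v.
Proof.
by move=> eF /orP [] /eqP ev; rewrite deg_inE (bigD1 e) //= ev eqxx ?addn1 -?addnA.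
Qed.

Lemma deg_gt0 F v : 0 < deg F v -> v \in vset F.
Proof.
rewrite deg_inE lt0n sum_nat_eq0 => /forall_inPn [e eF]; rewrite addn_eq0 !eqb0 negb_and !negbK.
by move=> H; rewrite inE; apply/existsP; exists e; rewrite eF.
Qed.

Lemma vsetP F v : reflect (exists2 e, e \in F & incident ends e v) (v \in vset F).
Proof.
by rewrite inE; apply: (iffP existsP) => [[e /andP [] ]|[e eF]]; exists e => //; rewrite eF.
Qed.

Lemma vset_ind F X : F \subset ind X -> vset F \subset X.
Proof.
move=> /subsetP sF; apply/subsetP => v /vsetP [e /sF].
by rewrite inE => /andP [e1 e2] /orP [/eqP <- | /eqP <-].
Qed.

Lemma indS X Y : X \subset Y -> ind X \subset ind Y.
Proof.
move=> /subsetP sXY; apply/subsetP => e.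
by rewrite [e \in ind X]inE [e \in ind Y]inE => /andP [/sXY -> /sXY ->].
Qed.

Lemma ind_vset F : F \subset ind (vset F).
Proof.
apply/subsetP => e eF; rewrite inE; apply/andP; split; apply/vsetP; exists e => //;
by rewrite /incident eqxx ?orbT.
Qed.

Lemma sum_deg_vset F : \sum_(v in vset F) deg F v = (#|F|).*2.
Proof.
rewrite -sum_deg_all big_mkcond; apply: eq_bigr => v _.
by case: ifP => // /negP H; apply/esym/eqP; rewrite -leqn0 leqNgt; apply/negP => /deg_gt0.
Qed.

Lemma adj_sym F : symmetric (adj ends F).
Proof. by move=> x y; apply: eq_existsb => e; rewrite orbC. Qed.

Lemma adj_edge F e : e \in F -> adj ends F (ends e).1 (ends e).2.
Proof. by move=> eF; apply/existsP; exists e; rewrite eF -surjective_pairing eqxx. Qed.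

Lemma closedE F X : (forall e, e \in F -> ((ends e).1 \in X) = ((ends e).2 \in X)) ->
  closed (adj ends F) X.
Proof.
move=> H x y /existsP [e /andP [eF]].
by case/orP => /eqP de; have := H e eF; rewrite de.
Qed.

(* A smallest nonempty edge set with at least as many edges as vertices is a cycle. *)
Lemma has_cycle_count F : F != set0 -> #|vset F| <= #|F| -> has_cycle ends F.
Proof.
have [k] := ubnP #|F|; elim: k F => // k IH F ltFk nF leF.
have IH' F' : F' \proper F -> F' != set0 -> #|vset F'| <= #|F'| -> has_cycle ends F.
  move=> pF' nF' le'; have [|C [sC cC]] := IH F' _ nF' le'.
    by rewrite -ltnS (leq_trans _ ltFk) // ltnS proper_card.
  by exists C; split=> //; apply: subset_trans sC (proper_sub pF').
have [[F' [pF' nF' le']] | nosub] : (exists F', [/\ F' \proper F, F' != set0 & #|vset F'| <= #|F'|]) \/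
    (forall F', F' \proper F -> F' != set0 -> #|F'| < #|vset F'|).
  have [/existsP [F' /and3P [? ? ?]] | no] :=
    boolP [exists F' : {set E}, [&& F' \proper F, F' != set0 & #|vset F'| <= #|F'|]].
    by left; exists F'.
  right=> F' p n; rewrite ltnNge; apply/negP => le.
  by case/existsP: no; exists F'; rewrite p n le.
  exact: IH' pF' nF' le'.
(* A leaf could be dropped with its edge, contradicting minimality of [F]. *)
have deg2 v : v \in vset F -> 2 <= deg F v.
  case/vsetP => e eF ev; rewrite ltnNge; apply/negP => d1.
  have d0 : deg (F :\ e) v = 0.
    move: d1; rewrite !deg_inE (bigD1 e) //=.
    have -> : \sum_(i in F :\ e) (((ends i).1 == v) + ((ends i).2 == v)) =
      \sum_(i in F | i != e) (((ends i).1 == v) + ((ends i).2 == v)).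
      by apply: eq_bigl => i; rewrite !inE andbC.
    by move: ev; rewrite /incident; lia.
  have nloop : (ends e).1 != (ends e).2.
    apply/eqP => ee; move: d1; rewrite deg_inE (bigD1 e) //=.
    by move: ev; rewrite /incident ee orbb => ->.
  have vF : v \in vset F by apply/vsetP; exists e.
  have svF : vset (F :\ e) \subset vset F :\ v.
    apply/subsetP => w /vsetP [f fF fw]; rewrite !inE; apply/andP; split.
      by apply: contraTneq (deg_incident fF fw) => ->; rewrite d0.
    by apply/existsP; exists f; move: fF; rewrite !inE => /andP [_ ->].
  have [F0 | F0] := eqVneq (F :\ e) set0.
    have : [set (ends e).1; (ends e).2] \subset vset F.
      by apply/subsetP => w; rewrite !inE => /orP [] /eqP ->; apply/existsP;
        exists e; rewrite eF /incident eqxx ?orbT.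
    move/subset_leq_card; rewrite cards2 nloop => c2.
    by move: leF; rewrite (cardsD1 e) eF F0 cards0; lia.
  have := nosub (F :\ e) (properD1 eF) F0; have := subset_leq_card svF.
  by move: leF; rewrite (cardsD1 e F) eF (cardsD1 v (vset F)) vF; lia.
have eqFv : #|F| = #|vset F|.
  apply/eqP; rewrite eqn_leq leF andbT.
  have [/set0Pn [e eF]] := nF.
  have [F0 | F0] := eqVneq (F :\ e) set0.
    rewrite (cardsD1 e) eF F0 cards0 card_gt0; apply/set0Pn; exists (ends e).1.
    by apply/vsetP; exists e; rewrite // /incident eqxx.
  have := nosub (F :\ e) (properD1 eF) F0.
  rewrite [in X in _ -> X](cardsD1 e F) eF add1n => H.
  apply: leq_trans H (subset_leq_card _); apply/subsetP => v /vsetP [f fF fv].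
  by apply/vsetP; exists f => //; move: fF; rewrite inE => /andP [].
exists F; split=> //; split=> //; split; last first.
  (* By [eqFv] the average degree is two, and no degree is smaller. *)
  move=> v vF; apply/eqP; rewrite eqn_leq deg2 // andbT leqNgt; apply/negP => d3.
  have := sum_deg_vset F; rewrite (bigD1 v) //=.
  have : \sum_(i in vset F | i != v) 2 <= \sum_(i in vset F | i != v) deg F i.
    by apply: leq_sum => i /andP [iF _]; apply: deg2.
  have : \sum_(i in vset F) 2 = (#|F|).*2 by rewrite sum_nat_const eqFv muln2.
  by rewrite (bigD1 v) //=; lia.
split.
  have [/set0Pn [e eF]] := nF; apply/set0Pn; exists (ends e).1.
  by apply/vsetP; exists e; rewrite // /incident eqxx.
move=> x y xF yF; apply/negPn/negP => nxy.
(* The component of [x] and the rest split [F] into two smaller parts. By minimality each has fewer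
   edges than vertices, contradicting the total. *)
pose X := [set v | connect (adj ends F) x v].
have clX e : e \in F -> ((ends e).1 \in X) = ((ends e).2 \in X).
  move=> eF; rewrite !inE; apply/idP/idP => H; apply: connect_trans H (connect1 _).
    exact: adj_edge.
  by rewrite adj_sym adj_edge.
pose F1 := F :&: ind X; pose F2 := F :\: ind X.
have dF : #|F1| + #|F2| = #|F| by exact: cardsID.
have F2E : F2 \subset ind (~: X).
  apply/subsetP => e; rewrite !inE => /andP [H eF]; move: H (clX e eF); rewrite !inE.
  by do 2!case: connect.
have dV : #|vset F1| + #|vset F2| <= #|vset F|.
  have -> : #|vset F1| + #|vset F2| = #|vset F1 :|: vset F2|.
    rewrite cardsU disjoint_setI0 ?cards0 ?subn0 // disjoints_subset.
    apply: subset_trans (vset_ind (subsetIr _ _)) _.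
    by rewrite -disjoints_subset disjoint_sym disjoints_subset vset_ind.
  apply: subset_leq_card; rewrite subUset; apply/andP; split; apply/subsetP => v /vsetP [e eF ev];
    apply/vsetP; exists e => //; by move: eF; rewrite inE => /andP [].
have nF1 : F1 != set0.
  case/vsetP: xF => e eF ex; apply/set0Pn; exists e; rewrite inE eF inE -clX // andbb.
  by case/orP: ex => /eqP ex; [| rewrite clX //]; rewrite ex inE connect0.
have nF2 : F2 != set0.
  case/vsetP: yF => e eF ey; apply/set0Pn; exists e; rewrite inE eF andbT inE -clX // andbb.
  by case/orP: ey => /eqP ey; [| rewrite clX //]; rewrite ey inE.
have p1 : F1 \proper F.
  by rewrite properEcard subsetIl -dF; move: nF2; rewrite -card_gt0; lia.
have p2 : F2 \proper F.
  by rewrite properEcard subsetDl -dF; move: nF1; rewrite -card_gt0; lia.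
have := nosub _ p1 nF1; have := nosub _ p2 nF2; lia.
Qed.

Hypothesis G3 : cubic ends.
Hypothesis G4 : cyclically_k_edge_connected ends 4.

Lemma sum_deg_cubic X : #|cut X| + (#|ind X|).*2 = 3 * #|X|.
Proof.
have := sum_deg_cut setT X; rewrite !setTI => <-.
by rewrite (eq_bigr _ (fun v _ => G3 v)) sum_nat_const mulnC.
Qed.

Lemma cutC X : cut (~: X) = cut X.
Proof. by apply/setP => e; rewrite !inE; do 2!case: (_ \in X). Qed.

(** Otherwise the cut would be a forbidden cycle-separating set; this is where the bound on such
    sets enters. *)
Lemma cut_ge4 X : has_cycle ends (ind X) -> has_cycle ends (ind (~: X)) -> 4 <= #|cut X|.
Proof.
move=> [C1 [sC1 cC1]] [C2 [sC2 cC2]]; rewrite leqNgt; apply/negP => lt4.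
case: G4 => _ /(_ _ lt4); apply.
have nc x y : x \in X -> y \notin X -> ~~ connect (adj ends (~: cut X)) x y.
  move=> xX yX; apply/negP => /(closed_connect (a := X)); rewrite xX (negPf yX).
  by move=> H; suff: true = false by []; apply/H/closedE => e; rewrite !inE negbK => /eqP.
have [x1 x1C] : exists x, x \in vset C1 by case: cC1 => _ [[/set0Pn]].
have [x2 x2C] : exists x, x \in vset C2 by case: cC2 => _ [[/set0Pn]].
have x1X : x1 \in X by apply: (subsetP (vset_ind sC1)).
have x2X : x2 \notin X by rewrite -in_setC; apply: (subsetP (vset_ind sC2)).
split; first by exists x1, x2; apply: nc.
exists C1, C2, x1, x2; split; split=> //; last exact: nc.
  apply: subset_trans sC1 _; apply/subsetP => e; rewrite !inE => /andP [-> ->] //.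
by apply: subset_trans sC2 _; apply/subsetP => e; rewrite !inE => /andP [/negPf -> /negPf ->].
Qed.

Lemma ind_cycle X : X != set0 -> has_cycle ends (ind X) \/ #|ind X| < #|X|.
Proof.
move=> nX; case: (leqP #|X| #|ind X|) => le; [left | by right].
apply: has_cycle_count; first by rewrite -card_gt0 (leq_trans _ le) ?card_gt0.
exact: leq_trans (subset_leq_card (vset_ind (subxx _))) le.
Qed.

(** A side with fewer inner edges than vertices has a cut of size at least its order plus two, by
    cubicity. If neither side is of this kind, both contain cycles. *)
Lemma cut_ge3 X : X != set0 -> X != setT -> 3 <= #|cut X|.
Proof.
move=> n0 nT; have nC : ~: X != set0 by rewrite -(@setCT V) (inj_eq (@setC_inj _)).
have [c1 | ] := ind_cycle n0; last first.
  by have := sum_deg_cubic X; move: n0; rewrite -card_gt0; lia.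
have [c2 | ] := ind_cycle nC; last first.
  by have := sum_deg_cubic (~: X); rewrite cutC; move: nC; rewrite -card_gt0; lia.
exact: ltnW (cut_ge4 c1 c2).
Qed.

(** * Counting components by their cuts *)

Section Components.
Variable F : {set E}.
Notation rt := (fingraph.root (adj ends F)).

(** One canonical vertex per component of the spanning subgraph (V, F), isolated vertices
    included. *)
Definition comp_roots : {set V} := [set r | rt r == r].
Definition edge_roots : {set V} := [set r in comp_roots | [exists e in F, rt (ends e).1 == r]].
Definition comp (r : V) : {set V} := [set v | rt v == r].

Lemma rt_edge e : e \in F -> rt (ends e).1 = rt (ends e).2.
Proof.
move=> eF; apply/eqP; rewrite root_connect ?connect1 ?adj_edge //.
exact: sym_connect_sym (adj_sym F).
Qed.

Lemma rt_rt v : rt (rt v) = rt v.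
Proof. by apply: root_root; apply: sym_connect_sym (adj_sym F). Qed.

Lemma rt_comp_roots v : rt v \in comp_roots.
Proof. by rewrite inE rt_rt. Qed.

Lemma comp_proper r : 2 <= #|comp_roots| -> r \in comp_roots ->
  comp r != set0 /\ comp r != setT.
Proof.
move=> c2 rR; split.
  by apply/set0Pn; exists r; rewrite inE; rewrite inE in rR.
apply/eqP => cT; move: c2; rewrite (cardsD1 r) rR add1n ltnS card_gt0 => /set0Pn [s].
rewrite !inE => /andP [sr /eqP sR]; have : s \in comp r by rewrite cT.
by rewrite inE sR (negPf sr).
Qed.

Lemma cut_comp r : cut (comp r) \subset ~: F.
Proof.
apply/subsetP => e; rewrite !inE; apply: contraNN => eF.
by rewrite (rt_edge eF).
Qed.

(** Component cuts consist of edges outside [F], each counted at most once per end. *)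
Lemma sum_comp (h : V -> nat) : (forall r, r \in comp_roots -> h r <= #|cut (comp r)|) ->
  \sum_(r in comp_roots) h r <= (#|~: F|).*2.
Proof.
move=> H; rewrite -sum_deg_all [leqRHS](partition_big rt (fun r => r \in comp_roots)) => [|v _]; last exact: rt_comp_roots.
apply: leq_sum => r rR; apply: leq_trans (H r rR) _.
rewrite (eq_bigl (mem (comp r))) => [|v]; last by rewrite !inE.
by rewrite sum_deg_cut (setIidPr (cut_comp r)) leq_addr.
Qed.

Lemma comp_count : 2 <= #|comp_roots| -> 3 * #|comp_roots| <= (#|~: F|).*2.
Proof.
move=> c2; have := @sum_comp (fun=> 3); rewrite sum_nat_const mulnC; apply=> r rR.
by have [n0 nT] := comp_proper c2 rR; apply: cut_ge3.
Qed.

(** Without leaves, a component with an edge has at least as many edges as vertices. *)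
Lemma comp_cycle r : (forall e v, e \in F -> incident ends e v -> 2 <= deg F v) ->
  r \in edge_roots -> has_cycle ends (ind (comp r)).
Proof.
move=> d2; rewrite !inE => /andP [_ /existsP [e /andP [eF er]]].
pose Fr := F :&: ind (comp r).
have [||C [sC cC]] := @has_cycle_count Fr; last by exists C; split=> //; apply: subset_trans sC (subsetIr _ _).
  by apply/set0Pn; exists e; rewrite !inE eF er -rt_edge.
have cl f v : f \in F -> incident ends f v -> v \in comp r -> f \in Fr.
  by move=> fF /orP [] /eqP <-; rewrite !inE fF -(rt_edge fF) => ->.
rewrite -leq_double -sum_deg_vset -muln2 -sum_nat_const; apply: leq_sum => v vFr.
have vr : v \in comp r by apply: (subsetP (vset_ind (subsetIr F _))).
case/vsetP: vFr => f; rewrite inE => /andP [fF _] fv.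
rewrite (leq_trans (d2 f v fF fv)) // !deg_inE [leqLHS]big_mkcond [leqRHS]big_mkcond leq_sum // => g _.
case: ifP => // gF; have [gv | ngv] := boolP (incident ends g v); first by rewrite (cl _ _ gF gv vr).
by move: ngv; rewrite /incident negb_or => /andP [/negPf -> /negPf ->].
Qed.

(** Every component cut has at least three edges. Around a component with edges it has at least
    four, since a second such component puts a cycle on the other side. *)
Lemma comp_count_cycles : (forall e v, e \in F -> incident ends e v -> 2 <= deg F v) ->
  2 <= #|edge_roots| -> 3 * #|comp_roots| + #|edge_roots| <= (#|~: F|).*2.
Proof.
move=> d2 b2; have sR : edge_roots \subset comp_roots by apply/subsetP => r; rewrite inE => /andP [].
have c2 := leq_trans b2 (subset_leq_card sR).
have -> : 3 * #|comp_roots| + #|edge_roots| = \sum_(r in comp_roots) (3 + (r \in edge_roots)).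
  rewrite big_split /= sum_nat_const mulnC; congr (_ + _).
  rewrite -sum1_card [LHS]big_mkcond [RHS]big_mkcond; apply: eq_bigr => r _ /=.
  by case: ifP => [/(subsetP sR) -> //|_]; case: ifP.
apply: sum_comp => r rR; have [n0 nT] := comp_proper c2 rR.
have [rb | _] := boolP (r \in edge_roots); last by rewrite addn0 cut_ge3.
apply: cut_ge4; first exact: comp_cycle.
move: b2; rewrite (cardsD1 r) rb add1n ltnS card_gt0 => /set0Pn [s /setD1P [sr sb]].
have [C [sC cC]] := comp_cycle d2 sb; exists C; split=> //; apply: subset_trans sC _.
have sub : comp s \subset ~: comp r.
  by apply/subsetP => v; rewrite !inE => /eqP ->.
exact: indS.
Qed.

End Components.
End Counting.

(** * Flows of the incidence matrix *)

Section Incidence.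
Local Open Scope ring_scope.
Variables (V E : finType) (ends : E -> V * V).
Implicit Types (F : {set E}) (X Y : {set V}) (S : 'M[rat]_#|E|).

(** Each edge is oriented as [ends] lists it; a loop gets a zero row and so carries a flow by
    itself. *)
Definition incidence : 'M[rat]_(#|E|, #|V|) :=
  \matrix_(i, j) (((ends (enum_val i)).1 == enum_val j)%:R -
                  ((ends (enum_val i)).2 == enum_val j)%:R).
Notation flows := (flows incidence).
Notation radical := (radical incidence).
Notation deg := (deg_in ends).

(** The rank of [F] in the graphic matroid. *)
Definition cut_rank F := \rank (onmx F *m incidence).

Lemma card_flows F : (cut_rank F + \rank (flows F) = #|F|)%N.
Proof. exact: rank_flows. Qed.

Lemma onmx_mulE F p (A : 'M[rat]_(#|E|, p)) i j :
  (onmx F *m A) i j = (enum_val i \in F)%:R * A i j.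
Proof. by rewrite mul_diag_mx !mxE. Qed.

Lemma incidence_sum : incidence *m const_mx 1 = 0 :> 'cV_#|E|.
Proof.
have H (a : V) : \sum_(j < #|V|) ((a == enum_val j)%:R : rat) = 1.
  rewrite (bigD1 (enum_rank a)) //= enum_rankK eqxx big1 ?addr0 // => j ja.
  by case: eqP => // aj; rewrite aj enum_valK eqxx in ja.
apply/matrixP => i j; rewrite !mxE.
under eq_bigr => k _ do rewrite !mxE mulr1.
by rewrite sumrB !H subrr.
Qed.

(** Columns of vertices outside [Y] vanish, and all columns sum to zero, so one column in [Y] is
    redundant. *)
Lemma cut_rank_lt F Y : Y != set0 -> F \subset induced_edges ends Y -> (cut_rank F < #|Y|)%N.
Proof.
case/set0Pn => y0 y0Y sF; rewrite /cut_rank -mxrank_tr; pose X := (onmx F *m incidence)^T.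
rewrite (cardsD1 y0 Y) y0Y add1n ltnS -/X.
apply: (rank_row_span (u := fun y => row (enum_rank y) X)).
have other i : i != enum_rank y0 -> (row i X <= \sum_(r in Y :\ y0) <<row (enum_rank r) X>>)%MS.
  move=> iy0; have [iY | iY] := boolP (enum_val i \in Y).
    apply: (sumsmx_sup (enum_val i)); last by rewrite enum_valK genmxE.
    rewrite !inE iY andbT; apply: contraNneq iy0 => <-; by rewrite enum_valK.
  have -> : row i X = 0; last exact: sub0mx.
  apply/rowP => k; rewrite mxE /X mxE onmx_mulE [RHS]mxE mxE.
  have [/(subsetP sF) | _] := boolP (enum_val k \in F); last by rewrite mul0r.
  rewrite inE => /andP [k1 k2].
  have H a : a \in Y -> (a == enum_val i) = false.
    by move=> aY; apply: contraNF iY => /eqP <-.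
  by rewrite !H // subrr mulr0.
move=> i; have [-> | ] := eqVneq i (enum_rank y0); last exact: other.
have -> : row (enum_rank y0) X = - \sum_(j | j != enum_rank y0) row j X.
  suff tot : \sum_j row j X = 0.
    by apply/eqP; move: tot; rewrite (bigD1 (enum_rank y0)) //= => /eqP; rewrite addr_eq0.
  apply/rowP => k; rewrite summxE [RHS]mxE.
  have := incidence_sum; move/(congr1 (mulmx (onmx F))); rewrite mulmx0 mulmxA.
  move/colP/(_ k); rewrite mxE [RHS]mxE => sum0; rewrite -[RHS]sum0; apply: eq_bigr => j _.
  by rewrite mxE [const_mx _ _ _]mxE mulr1 /X mxE.
by rewrite eqmx_opp summx_sub.
Qed.

(** A potential killed by the incidences of [F] is constant on components, hence determined by its
    values at the roots. *)
Lemma cut_rank_ge F : (#|V| <= cut_rank F + #|comp_roots ends F|)%N.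
Proof.
pose X := kermx (onmx F *m incidence)^T.
have rX : (cut_rank F + \rank X = #|V|)%N.
  by rewrite mxrank_ker mxrank_tr /cut_rank subnKC // rank_leq_col.
rewrite -rX leq_add2l -mxrank_tr.
apply: (rank_row_span (u := fun y => row (enum_rank y) X^T)) => i.
apply: (sumsmx_sup (fingraph.root (adj ends F) (enum_val i))); first exact: rt_comp_roots.
rewrite genmxE; set r := fingraph.root _ _.
suff -> : row i X^T = row (enum_rank r) X^T by [].
apply/rowP => k; do 2!rewrite [LHS]mxE [RHS]mxE.
pose A := [set v | X k (enum_rank v) == X k i].
have : r \in A; last by rewrite inE => /eqP ->.
rewrite -(closed_connect (a := A) _ (connect_root (adj ends F) (enum_val i))).
  by rewrite inE enum_valK.
apply: closedE => e eF; rewrite !inE.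
suff -> : X k (enum_rank (ends e).1) = X k (enum_rank (ends e).2) by [].
have := mulmx_ker (onmx F *m incidence)^T => /matrixP/(_ k (enum_rank e)).
have H (a : V) : \sum_(j < #|V|) (X k j * (a == enum_val j)%:R) = X k (enum_rank a).
  rewrite (bigD1 (enum_rank a)) //= enum_rankK eqxx mulr1 big1 ?addr0 // => j ja.
  by case: eqP => [aj|]; rewrite ?mulr0 //; rewrite aj enum_valK eqxx in ja.
rewrite -/X mxE [RHS]mxE; under eq_bigr => j _ do
  rewrite [_^T _ _]mxE onmx_mulE [incidence _ _]mxE enum_rankK eF mul1r mulrBr.
by rewrite sumrB !H => /eqP; rewrite subr_eq0 => /eqP.
Qed.

(** Conservation at a leaf makes every flow vanish on its edge. *)
Lemma flow_deg F e v : flows F *m at_edge e != 0 -> incident ends e v -> (2 <= deg F v)%N.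
Proof.
move=> nz ev; have eF := flows_edge nz; rewrite ltnNge; apply/negP => d1.
case/eqP: nz; have [zD z0] := flowsP _ _ _ (submx_refl (flows F)).
move: d1; rewrite deg_inE (bigD1 e) //= => d1.
have d1e : (((ends e).1 == v) + ((ends e).2 == v) = 1)%N by move: ev d1; rewrite /incident; lia.
have d0 f : f \in F -> f != e -> ~~ incident ends f v.
  move=> fF fe; move: d1; rewrite d1e (bigD1 f) /=; last by rewrite fF.
  by rewrite /incident; lia.
apply/matrixP => i j; rewrite mul_at_edge !mxE.
have /matrixP/(_ i (enum_rank v)) := zD.
rewrite !mxE (bigD1 (enum_rank e)) //= big1 ?addr0 => [|k ke].
  rewrite !mxE !enum_rankK => /eqP; rewrite mulf_eq0 => /orP [/eqP // | ].
  by move: d1e; case: (_ == v); case: (_ == v).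
have [kF | /z0] := boolP (enum_val k \in F).
  have ke' : enum_val k != e by apply: contraNneq ke => <-; rewrite enum_valK.
  have := d0 _ kF ke'; rewrite /incident negb_or !mxE enum_rankK => /andP [/negPf -> /negPf ->].
  by rewrite subrr mulr0.
by rewrite mul_at_edge enum_valK => /matrixP/(_ i 0); rewrite !mxE => ->; rewrite mul0r.
Qed.

(** A cycle has as many edges as vertices, but its [cut_rank] is smaller, so it carries a flow. *)
Lemma no_flow_no_cycle F : flows F = 0 -> ~ has_cycle ends F.
Proof.
move=> F0 [C [sC [nC [_ dC]]]].
have C0 : flows C = 0.
  by apply/eqP; rewrite -submx0 -F0 flowsS.
have := card_flows C; rewrite C0 mxrank0 addn0 => cC.
have nV : vset ends C != set0.
  have /set0Pn [e eC] := nC; apply/set0Pn; exists (ends e).1.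
  by apply/vsetP; exists e; rewrite // /incident eqxx.
have := cut_rank_lt nV (ind_vset ends C); rewrite cC.
have := sum_deg_vset ends C; rewrite (eq_bigr _ dC) sum_nat_const; lia.
Qed.

Definition edge_adj : rel E := fun e f => [exists v, incident ends e v && incident ends f v].

Lemma edge_adj_sym : symmetric edge_adj.
Proof. by move=> e f; apply: eq_existsb => v; rewrite andbC. Qed.

Definition generic S := [/\ skew_mx S,
  forall e f, S (enum_rank e) (enum_rank f) != 0 -> edge_adj e f &
  forall F e f, edge_adj e f -> radical S F *m wedge e f *m (radical S F)^T = 0].

Lemma wedge_form p (K : 'M[rat]_(p, #|E|)) e f i j : (K *m wedge e f *m K^T) i j =
  K i (enum_rank e) * K j (enum_rank f) - K i (enum_rank f) * K j (enum_rank e).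
Proof.
have H a b : (K *m delta_mx a b *m K^T) i j = K i a * K j b.
  rewrite -(mul_delta_mx (0 : 'I_1)) mulmxA -colE -mulmxA -rowE mxE big_ord1 !mxE //.
by rewrite /wedge mulmxBr mulmxBl !mxE -!H !mxE.
Qed.

(* On the radical the coordinates at adjacent edges are proportional as functionals,
   hence so are all coordinates at the edges of one component. *)
Lemma radical_rank_components S F : generic S ->
  (forall e, e \in F -> radical S F *m at_edge e != 0) ->
  (\rank (radical S F) <= #|edge_roots ends F|)%N.
Proof.
move=> [_ _ gS] miss; pose K := radical S F; rewrite -/K -mxrank_tr.
pose w e := row (enum_rank e) K^T.
have step e f : f \in F -> edge_adj e f -> (w e <= w f)%MS.
  move=> fF ef; have [j Kj] : exists j, K j (enum_rank f) != 0.
    apply/existsP; apply: contraR (miss _ fF); rewrite negb_exists => /forallP H.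
    by apply/eqP/matrixP => a b; rewrite mul_at_edge !mxE; apply/eqP/negPn/H.
  have -> : w e = (K j (enum_rank e) / K j (enum_rank f)) *: w f.
    apply/rowP => i; rewrite !mxE.
    have /matrixP/(_ i j) := gS F e f ef; rewrite wedge_form -/K mxE => /eqP.
    rewrite subr_eq0 => /eqP Kij; apply: (mulIf Kj).
    by rewrite mulrAC divfK // Kij mulrC.
  exact: scalemx_sub.
have conn x y e f : connect (adj ends F) x y -> e \in F -> incident ends e x ->
    f \in F -> incident ends f y -> (w e <= w f)%MS.
  case/connectP => p; elim: p x e => [|x' p IH] x e /=.
    move=> _ -> eF ex fF fx; apply: step => //; apply/existsP; exists x; exact/andP.
  case/andP => /existsP [g /andP [gF gxx]] px y_last eF ex fF fy.
  have [gx gx'] : incident ends g x /\ incident ends g x'.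
    by rewrite /incident; case/orP: gxx => /eqP ->; rewrite /= !eqxx ?orbT.
  apply: submx_trans (IH x' g px y_last gF gx' fF fy).
  by apply: step => //; apply/existsP; exists x; apply/andP.
(* One edge coordinate represents each component; at an edge root the pick succeeds, so the default
   0 does not arise there. *)
pose u r := if [pick f in F | fingraph.root (adj ends F) (ends f).1 == r] is Some f then w f else 0.
apply: (rank_row_span (u := u)) => i; pose e := enum_val i.
have [eF | eF] := boolP (e \in F); last first.
  have -> : row i K^T = 0; last exact: sub0mx.
  have [/flowsP [_ H] _] := radicalP _ _ _ _ (submx_refl K).
  apply/rowP => k; rewrite !mxE; have /matrixP/(_ k 0) := H e eF.
  by rewrite mul_at_edge enum_valK !mxE.
pose r := fingraph.root (adj ends F) (ends e).1.
apply: (sumsmx_sup r).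
  by rewrite inE rt_comp_roots; apply/existsP; exists e; rewrite eF eqxx.
rewrite genmxE /u; case: pickP => [f /andP [fF /eqP fr] | /(_ e)]; last by rewrite eF eqxx.
have -> : row i K^T = w e by rewrite /w enum_valK.
apply: (conn (ends e).1 (ends f).1) => //; rewrite ?/incident ?eqxx //.
by rewrite -root_connect ?fr //; apply: sym_connect_sym (adj_sym ends F).
Qed.

(** * Bounding the radical and building the tree *)

Hypothesis G3 : cubic ends.
Hypothesis G4 : cyclically_k_edge_connected ends 4.

(** Reduce to [F0], on each edge of which the radical is nonzero. Its radical still has rank at
    least two, so at least two components have edges, and [F0] has no leaves: the count of component
    cuts applies. *)
Lemma radical_bound S F Y : generic S -> (2 <= \rank (radical S F))%N ->
  (forall v, v \in Y -> deg F v = 0%N) ->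
  (#|V|.*2 + 4 + #|Y| <= (cut_rank F + #|~: F|).*2)%N.
Proof.
move=> gS; have [sS _ _] := gS => d2 Y0.
have [F0 [sF0 miss leF0]] := missed_everywhere incidence F sS.
have z0 := mxrankS (flowsS incidence sF0).
have b := radical_rank_components gS miss.
have deg2 e v : e \in F0 -> incident ends e v -> (2 <= deg F0 v)%N.
  move=> /miss ne; apply: flow_deg; apply: mul_at_edge_neq0 ne.
  by have [] := radicalP _ _ _ _ (submx_refl (radical S F0)).
have cc := comp_count_cycles G3 G4 deg2.
have ge := cut_rank_ge F0.
have YR : (#|Y| + #|edge_roots ends F0| <= #|comp_roots ends F0|)%N.
  have dY v e : v \in Y -> e \in F0 -> incident ends e v = false.
    move=> vY eF0; apply/negP => /(deg_incident (subsetP sF0 _ eF0)).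
    by rewrite Y0.
  have rY v : v \in Y -> fingraph.root (adj ends F0) v = v.
    move=> vY; have := connect_root (adj ends F0) v; case/connectP => [[|x p]] /=.
      by move=> _ ->.
    case/andP => /existsP [e /andP [eF0 evx]] _ _.
    have := dY v e vY eF0; rewrite /incident.
    by case/orP: evx => /eqP ->; rewrite /= eqxx ?orbT.
  have -> : (#|Y| + #|edge_roots ends F0| = #|Y :|: edge_roots ends F0|)%N.
    rewrite cardsU disjoint_setI0 ?cards0 ?subn0 //.
    apply/pred0P => v /=; apply/negP => /andP [vY]; rewrite inE => /andP [_ /existsP [e /andP [eF0 /eqP er]]].
    have := connect_root (adj ends F0) (ends e).1; rewrite er => c.
    have : connect (adj ends F0) v (ends e).1.
      by rewrite (sym_connect_sym (adj_sym ends F0)).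
    case/connectP => [[|x p]] /=.
      by move=> _ ev; have := dY v e vY eF0; rewrite /incident ev eqxx.
    case/andP => /existsP [g /andP [gF0 gvx]] _ _.
    have := dY v g vY gF0; rewrite /incident.
    by case/orP: gvx => /eqP ->; rewrite /= eqxx ?orbT.
  apply: subset_leq_card; rewrite subUset; apply/andP; split; apply/subsetP => v.
    by move=> vY; rewrite inE rY.
  by rewrite inE => /andP [].
(* Let [F0] have c components, b of them with edges, and let d be the radical rank for [F]. Twice
   [#|E| - \rank (flows F)] is at least (3c + b) + 2(n - c) + 2(d - b) = 2n + (c - b) + 2d, where c
   - b is at least [#|Y|] and d at least 2. *)
have := card_flows F; have := card_flows F0.
have := cardsC F; have := cardsC F0; lia.
Qed.

Lemma deg_inD1 F e v : e \in F ->
  (deg F v = deg (F :\ e) v + (((ends e).1 == v) + ((ends e).2 == v)))%N.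
Proof.
move=> eF; rewrite !deg_inE [LHS](bigD1 e) //= addnC; congr (_ + _)%N.
by apply: eq_bigl => f; rewrite !inE andbC.
Qed.

(* J collects a common end v of each deleted pair; being cubic, v keeps at most one
   edge, so it is not chosen again. *)
Lemma delete_pairs S F : generic S -> radical S F = 0 ->
  exists (J : {set V}) (T : {set E}),
  [/\ T \subset F, flows T = 0, \rank (flows F) = (#|J|.*2)%N & #|F| = (#|T| + #|J|.*2)%N] /\
  [/\ forall e, e \in F -> e \notin T -> exists2 v, v \in J & incident ends e v,
      forall v, v \in J -> (deg T v <= 1)%N & forall v, v \in J -> (2 <= deg F v)%N].
Proof.
move=> gS; have [sS Sadj _] := gS.
have [k] := ubnP (\rank (flows F)); elim: k F => // k IH F ltFk r0.
have [F0 | nF] := eqVneq (flows F) 0.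
  exists set0, F; rewrite F0 mxrank0 cards0; split; split=> //; rewrite ?addn0 //.
  - by move=> e ->.
  - by move=> v; rewrite inE.
  - by move=> v; rewrite inE.
have [e [f [eF fF Sfe r0' rk]]] := nondegenerate_pair sS r0 nF.
have [|J [T [[sT T0 rJ cT] [cov leaf dJ]]]] := IH (F :\ e :\ f) _ r0'.
  by rewrite -rk in ltFk; lia.
have /existsP [v /andP [fv ev]] := Sadj _ _ Sfe.
have degv : deg F v = (deg (F :\ e :\ f) v + (((ends f).1 == v) + ((ends f).2 == v)) +
    (((ends e).1 == v) + ((ends e).2 == v)))%N by rewrite (deg_inD1 v eF) (deg_inD1 v fF).
have d3 : (deg F v <= 3)%N by rewrite -(G3 v) deg_inS ?subsetT.
have dv : (deg (F :\ e :\ f) v <= 1)%N by move: fv ev d3; rewrite degv /incident; clear; lia.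
have vJ : v \notin J by apply/negP => /dJ; rewrite ltnNge dv.
have sF : F :\ e :\ f \subset F by rewrite (subset_trans (subD1set _ _)) ?subD1set.
exists (v |: J), T; rewrite cardsU1 vJ; split; split=> //.
- exact: subset_trans sT sF.
- by rewrite -rk rJ add1n doubleS.
- by move: cT; rewrite (cardsD1 e F) eF (cardsD1 f (F :\ e)) fF; clear; lia.
- move=> g gF gT; have [-> | ge] := eqVneq g e; first by exists v; rewrite ?setU11.
  have [-> | gf] := eqVneq g f; first by exists v; rewrite ?setU11.
  have [|w wJ gw] := cov g _ gT; first by rewrite !inE gf ge.
  by exists w; rewrite ?setU1r.
- move=> w /setU1P [-> | /leaf //]; exact: leq_trans (deg_inS _ _ sT) dv.
- move=> w /setU1P [-> | /dJ d2]; last exact: leq_trans d2 (deg_inS _ _ sF).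
  by move: fv ev; rewrite degv /incident; clear; lia.
Qed.

(** If the rank were one, deleting an edge where the radical is nonzero would leave a zero radical.
    The remaining flows then pair off, so [flows F] would have odd rank. *)
Lemma radical_even S F : generic S -> (\rank (radical S F) <= 1)%N ->
  ~~ odd (\rank (flows F)) -> radical S F = 0.
Proof.
move=> gS le1 ev; have [sS _ _] := gS; apply/eqP/negPn/negP => nz.
have [e ne] : exists e, radical S F *m at_edge e != 0.
  apply/existsP; apply: contraR nz; rewrite negb_exists => /forallP H.
  apply/eqP/matrixP => i j; have := H (enum_val j); rewrite negbK => /eqP/matrixP/(_ i 0).
  by rewrite mul_at_edge enum_valK !mxE.
have r0 : radical S (F :\ e) = 0.
  by apply/eqP; rewrite -mxrank_eq0; have := radicalD1_missed sS ne; lia.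
have [J [T [[_ _ rJ _] _]]] := delete_pairs gS r0.
have nzF : flows F *m at_edge e != 0.
  by apply: mul_at_edge_neq0 ne; have [] := radicalP _ _ _ _ (submx_refl (radical S F)).
by move: ev; rewrite -(rank_flowsD1 nzF) rJ /= odd_double.
Qed.

Lemma acyclic_ind_lt A X : flows (induced_edges ends A) = 0 -> X \subset A -> X != set0 ->
  (#|induced_edges ends X| < #|X|)%N.
Proof.
move=> A0 XA nX; rewrite -card_flows.
have -> : flows (induced_edges ends X) = 0.
  by apply/eqP; rewrite -submx0 -A0 flowsS // indS.
by rewrite mxrank0 addn0 cut_rank_lt.
Qed.

(** Two separated parts would each have fewer edges than vertices, leaving at most [#|A| - 2]
    edges. *)
Lemma acyclic_tree A : A != set0 -> flows (induced_edges ends A) = 0 ->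
  (#|A| <= #|induced_edges ends A|.+1)%N -> induced_tree ends A.
Proof.
move=> nA A0 leA; split; last exact: no_flow_no_cycle.
split=> // x y xA yA; apply/negPn/negP => nxy.
pose P := [set v in A | connect (adj ends (induced_edges ends A)) x v].
have PA : P \subset A by apply/subsetP => v; rewrite inE => /andP [].
have nP : P != set0 by apply/set0Pn; exists x; rewrite inE xA connect0.
have nQ : A :\: P != set0 by apply/set0Pn; exists y; rewrite !inE yA nxy.
have ltP := acyclic_ind_lt A0 PA nP.
have ltQ := acyclic_ind_lt A0 (subsetDl A P) nQ.
have cA := cardsID P A; rewrite (setIidPr PA) in cA.
have : induced_edges ends A \subset induced_edges ends P :|: induced_edges ends (A :\: P).
  apply/subsetP => e eA; move: (eA); rewrite inE => /andP [e1 e2].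
  have : ((ends e).1 \in P) = ((ends e).2 \in P).
    rewrite !inE e1 e2 /=; apply/idP/idP => H; apply: connect_trans H (connect1 _).
      exact: adj_edge.
    by rewrite adj_sym adj_edge.
  rewrite in_setU [e \in induced_edges ends P]inE [e \in induced_edges ends (A :\: P)]inE.
  rewrite !in_setD e1 e2 !andbT => ->.
  by case: (_ \in P).
move/subset_leq_card; rewrite cardsU; lia.
Qed.

(** Every edge outside the forest [T] meets [J], so [T] contains all edges induced on the complement
    of [J]. It has [cut_rank F] edges and loses at most [#|J'|] of them at [J], which leaves enough
    for a tree. *)
Lemma tree_partition S F Y : generic S ->
  (forall e, e \notin F -> exists2 v, v \in Y & incident ends e v) ->
  (forall v, v \in Y -> deg F v = 0%N) ->
  (cut_rank F + #|Y|).+1 = #|V| -> (\rank (radical S F) <= 1)%N ->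
  ~~ odd (\rank (flows F)) ->
  exists A J : {set V}, [/\ A :|: J = setT, A :&: J = set0, induced_tree ends A &
    (#|induced_edges ends J| + #|~: F| = 3 * #|Y|)%N].
Proof.
move=> gS HF HY cV le1 ev; have r0 := radical_even gS le1 ev.
have [J' [T [[sT T0 rJ cT] [cov leaf dJ]]]] := delete_pairs gS r0.
pose J := Y :|: J'; exists (~: J), J.
have cF := card_flows F.
have dis : [disjoint Y & J'].
  by apply/pred0P => v /=; apply/negP => /andP [/HY d0 /dJ]; rewrite d0.
have cJ : #|J| = (#|Y| + #|J'|)%N by rewrite cardsU disjoint_setI0 // cards0 subn0.
have cA := cardsC J.
have sA : induced_edges ends (~: J) \subset T.
  apply/subsetP => e; rewrite !inE !negb_or => /andP [/andP [y1 j1] /andP [y2 j2]].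
  have nY v : incident ends e v -> v \notin Y by case/orP => /eqP <-.
  have nJ v : incident ends e v -> v \notin J' by case/orP => /eqP <-.
  have [eF | /HF [v vY /nY]] := boolP (e \in F); last by rewrite vY.
  by apply/negPn/negP => /(cov e eF) [v vJ /nJ]; rewrite vJ.
have dTJ : (\sum_(v in J) deg T v <= #|J'|)%N.
  rewrite -sum1_card [leqLHS]big_mkcond [leqRHS]big_mkcond leq_sum // => v _.
  rewrite in_setU; have [/leaf dv | _] := boolP (v \in J'); first by rewrite orbT.
  by rewrite orbF; case: ifP => // /HY <-; apply: deg_inS.
have dT : (#|T :\: induced_edges ends (~: J)| <= \sum_(v in J) deg T v)%N.
  rewrite sum_deg -sum1_card [leqLHS]big_mkcond [leqRHS]big_mkcond leq_sum // => e _.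
  rewrite in_setD; case: (e \in T); rewrite ?andbF // andbT.
  by rewrite inE !in_setC; do 2!case: (_ \in J).
have cTA := cardsID (induced_edges ends (~: J)) T; rewrite (setIidPr sA) in cTA.
have A0 : flows (induced_edges ends (~: J)) = 0.
  by apply/eqP; rewrite -submx0 -T0 flowsS.
(* If [J] were everything, [J'] would carry all degrees of [F]. Since [F] has at least [2 #|J'|]
   edges, [J'] would be empty and [Y] everything, contradicting [cV]. *)
have nA : ~: J != set0.
  rewrite -card_gt0 lt0n; apply/negP => /eqP A00.
  have : ((#|F|).*2 <= 3 * #|J'|)%N.
    rewrite -(sum_deg_all ends) (bigID (mem J')) /= [X in (_ + X)%N]big1 ?addn0 => [|v vJ].
      rewrite mulnC -sum_nat_const leq_sum // => v _.
      by rewrite -(G3 v) deg_inS ?subsetT.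
    apply: HY; have : v \in J by apply/negPn/negP; rewrite -in_setC (cards0_eq A00) inE.
    by rewrite inE (negPf vJ) orbF.
  lia.
have ltA := acyclic_ind_lt A0 (subxx _) nA.
have cub := sum_deg_cubic G3 J.
have all3 : #|E| = (#|induced_edges ends J| + #|induced_edges ends (~: J)| + #|cut ends J|)%N.
  rewrite -[#|E|]sum1_card -!sum1_card [X in (X + _ + _)%N]big_mkcond [X in (_ + X + _)%N]big_mkcond.
  rewrite [X in (_ + _ + X)%N]big_mkcond -!big_split /=; apply: eq_bigr => e _.
  rewrite [e \in induced_edges ends J]inE [e \in cut _ _]inE [e \in induced_edges ends _]inE !in_setC.
  by do 2!case: (_ \in J).
have cE := cardsC F.
split; first by rewrite setUC setUCr.
- by rewrite setIC setICr.
- by apply: acyclic_tree => //; lia.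
(* Equate [all3] with the count [#|T| + 2 #|J'| + #|~: F|] of the edges, and eliminate the cut by
   [cub]. *)
- lia.
Qed.

End Incidence.

Theorem theorem4 (V E : finType) (ends : E -> V * V) :
  cubic ends -> cyclically_k_edge_connected ends 4 ->
  exists A J : {set V},
    [/\ A :|: J = setT, A :&: J = set0,
        induced_tree ends A,
        independent ends J \/ near_independent ends J
      & (independent ends J <-> #|V| %% 4 = 2)].
Proof.
move=> G3 G4.
have cE : #|E|.*2 = 3 * #|V|.
  have := sum_deg_all ends setT; rewrite cardsT => <-.
  by rewrite (eq_bigr _ (fun v _ => G3 v)) sum_nat_const mulnC.
have nV : [set: V] != set0 by case: G4 => [[]].
have [S gS] : exists S, generic ends S.
  by have [S [? ? ?]] := exists_generic (incidence ends) (edge_adj_sym ends); exists S.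
have [n2 | n2] := eqVneq (#|V| %% 4) 2.
  have cr : (cut_rank ends setT).+1 = #|V|.
    have : [set: E] \subset induced_edges ends setT by apply/subsetP => e; rewrite !inE.
    move/(cut_rank_lt nV); rewrite cardsT => lt; apply/eqP; rewrite eqn_leq lt.
    (* With no edge deleted, [comp_count] excludes two components. *)
    have := cut_rank_ge ends setT; have := @comp_count _ _ _ G3 G4 setT.
    rewrite setCT cards0; lia.
  have HF (e : E) : e \notin setT -> exists2 v, v \in set0 & incident ends e v by rewrite inE.
  have HY (v : V) : v \in set0 -> deg_in ends setT v = 0 by rewrite inE.
  have cF := card_flows ends setT; rewrite cardsT in cF.
  have cV : (cut_rank ends setT + #|set0 : {set V}|).+1 = #|V| by rewrite cards0 addn0.
  (* Otherwise 2n + 4 would be at most 2(n - 1). *)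
  have d1 : \rank (radical (incidence ends) S setT) <= 1.
    rewrite leqNgt; apply/negP => d2; have := radical_bound G3 G4 gS d2 HY.
    rewrite setCT !cards0; lia.
  (* The rank is n/2 + 1. *)
  have ev : ~~ odd (\rank (flows (incidence ends) setT)) by lia.
  have [A [J [AJ AJ0 tA]]] := tree_partition G3 gS HF HY cV d1 ev.
  rewrite setCT !cards0 muln0 addn0 => cJ.
  by exists A, J; split=> //; left.
have [v0 _] := set0Pn _ nV.
(* By [cE] the order is even, hence here a positive multiple of 4. *)
have n4 : 4 <= #|V|.
  have : 0 < #|V| by rewrite -cardsT card_gt0.
  lia.
have proper (X : {set V}) : 0 < #|X| <= 2 -> 3 <= #|cut ends X|.
  case/andP => X0 X2; apply: cut_ge3 => //; first by rewrite -card_gt0.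
  by apply: contraTneq X2 => ->; rewrite cardsT; lia.
have [e0] : exists e, e \in cut ends [set v0].
  by apply/set0Pn; rewrite -card_gt0 (leq_trans _ (proper _ _)) ?cards1.
rewrite !inE => ne0.
have uw : (ends e0).1 != (ends e0).2 by apply: contraNneq ne0 => ->.
pose Y := [set (ends e0).1; (ends e0).2]; pose F := induced_edges ends (~: Y).
have cY : #|Y| = 2 by rewrite cards2 uw.
have cutY : 3 <= #|cut ends Y| by rewrite proper // cY.
have indY : 0 < #|induced_edges ends Y|.
  by rewrite card_gt0; apply/set0Pn; exists e0; rewrite !inE !eqxx orbT.
have cubY := sum_deg_cubic G3 Y; rewrite cY in cubY.
(* By [cubY], [cutY] and [indY], [Y] has one inner edge and four cut edges, so five edges lie
   outside [F]. *)
have cFC : #|~: F| = #|cut ends Y| + #|induced_edges ends Y|.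
  rewrite -!sum1_card [LHS]big_mkcond [X in X + _]big_mkcond [X in _ + X]big_mkcond.
  rewrite -big_split /=; apply: eq_bigr => e _.
  rewrite in_setC [e \in cut _ _]inE [e \in F]inE [e \in induced_edges _ _]inE !in_setC.
  by do 2!case: (_ \in Y).
have HF e : e \notin F -> exists2 v, v \in Y & incident ends e v.
  rewrite inE !in_setC negb_and !negbK.
  by case/orP => ?; [exists (ends e).1 | exists (ends e).2]; rewrite // /incident eqxx ?orbT.
have HY v : v \in Y -> deg_in ends F v = 0.
  move=> vY; apply/eqP; rewrite -leqn0 leqNgt; apply/negP => /deg_gt0.
  by move/(subsetP (vset_ind (subxx _))); rewrite in_setC vY.
have cFE := cardsC F; have cF := card_flows ends F; have cVY := cardsC Y.
have cV : (cut_rank ends F + #|Y|).+1 = #|V|.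
  have nY : ~: Y != set0 by rewrite -card_gt0; lia.
  have lt : cut_rank ends F < #|~: Y| by apply: cut_rank_lt.
  (* Five deleted edges allow at most three components, so the rank is exactly n - 3. *)
  have := cut_rank_ge ends F; have := @comp_count _ _ _ G3 G4 F.
  lia.
(* Otherwise 2n + 4 + 2 would be at most 2(n - 3 + 5). *)
have d1 : \rank (radical (incidence ends) S F) <= 1.
  by rewrite leqNgt; apply/negP => d2; have := radical_bound G3 G4 gS d2 HY; lia.
(* The rank is (3n/2 - 5) - (n - 3) = n/2 - 2. *)
have ev : ~~ odd (\rank (flows (incidence ends) F)) by lia.
have [A [J [AJ AJ0 tA cJ]]] := tree_partition G3 gS HF HY cV d1 ev.
have J1 : #|induced_edges ends J| = 1 by lia.
exists A, J; split=> //; first by right.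
by split=> [|/eqP]; [rewrite /independent J1 | rewrite (negPf n2)].
Qed.
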